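(* Let $a\ge 0$ be an integer and let $\rho=3\cdot 2^{a+1}$. Then every positive integer $n$ other than $14\cdot 2^{2a+2}$ is a sum of $4$ squares of integers in $S_\rho$. Furthermore, $14\cdot 2^{2a+2}$ is a sum of $5$ squares of integers in $S_\rho$, and hence $M(\rho)=5$.
   Context: For a positive integer $\rho$, let $S_\rho=\{n\in\mathbb{Z} : n\ge 0,\ n\neq\rho\}$ (note $0\in S_\rho$). For a positive integer $n$, let $k_\rho(n)$ be the least positive integer $m$ such that $n=x_1^2+\cdots+x_m^2$ for some $x_1,\dots,x_m\in S_\rho$, and $k_\rho(n)=\infty$ if no such $m$ exists. Let $I(\rho)=\{n\ge1 : k_\rho(n)=\infty\}$ and $M(\rho)=\max\{k_\rho(n) : n\ge 1,\ n\notin I(\rho)\}$. *)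

(* Defs.v *)
From mathcomp Require Import all_boot all_order boolp classical_sets.

Set Implicit Arguments.
Unset Strict Implicit.
Unset Printing Implicit Defensive.

Local Open Scope classical_set_scope.

(* The nonnegative integers are [nat]. *)
Definition S_ (rho : nat) : set nat := [set x | x <> rho].

(* Since [0] belongs to [S_ rho] when [rho > 0], "exactly [m] squares" and
   "at most [m] squares" agree for [m > 0]. *)
Definition sum_of_squares (rho m n : nat) : Prop :=
  exists x : 'I_m -> nat,
    (forall i, S_ rho (x i)) /\ n = \sum_(i < m) x i ^ 2.

(* [None] stands for infinity. *)
Definition k_ (rho n : nat) : option nat :=
  if pselect (exists m, `[< 0 < m /\ sum_of_squares rho m n >]) is left ex_m
  then Some (ex_minn ex_m) else None.

Definition I_ (rho : nat) : set nat :=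
  [set n | 1 <= n /\ k_ rho n = None].

Definition k_values (rho : nat) : set nat :=
  [set k | exists n, [/\ 1 <= n, ~ I_ rho n & k_ rho n = Some k]].

(* The default value [0] is taken exactly when the set of values has no
   maximum: by definition, a value of [k_ rho] is positive. *)
Definition M_ (rho : nat) : nat :=
  xget 0 [set m | k_values rho m /\ forall k, k_values rho k -> k <= m].

(* Main.v *)
(**
   Write rho = 3s with s = 2^k, and let n be even when s = 1.  If 8 divides n,
   double a representation of n/4 that avoids rho/2 (any one, for s = 1, since 3
   is odd).  If n = 4m with m odd, then n is a sum of four odd squares, and of
   four even ones for s = 1.  So let 4 not divide n, and take a representation
   with an entry 3s.

   If n = 1 mod 3, the three entries divisible by 3 include 3s <> 0, and they can
   be replaced by three entries prime to 3, because 9(x^2 + y^2 + z^2) has such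
   a representation unless 3 divides x, y and z.  If n = 0 mod 3 one arranges in
   the same way that exactly one entry is divisible by 3.  For n = 0 or 2 mod 3
   one reflects (3s, x, y), where x and y are prime to 3, in the vectors
   (1, +-1, +-1): this removes the entry 3s unless x/s and y/s lie in a finite
   list.  Such exceptional pairs force n to be a multiple of s^2, except when
   n = 2 mod 3 and the fourth entry 3e has e <> +-s; reflecting 3e instead of 3s
   then bounds e, and leaves finitely many n, among them 14 for rho = 3.
*)

From Stdlib Require Import ZArith Lia.
Require Import Defs.
From mathcomp Require Import all_boot all_order ssralg zmodp boolp classical_sets.

Set Implicit Arguments.
Unset Strict Implicit.
Unset Printing Implicit Defensive.

Ltac Zify.zify_post_hook ::= Z.to_euclidean_division_equations.

(** * Lagrange's four-square theorem *)

Section SquaresModP.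
Import GRing.Theory.
Local Open Scope ring_scope.

(** Pigeonhole: with h = (p + 1)/2, the values i^2 and -1 - j^2 for 0 <= i, j < h form two sets of h
    elements each, and 2h = p + 1 exceeds the size of ['F_p], so the sets meet. *)
Lemma sum_two_squares_Fp_eqN1 p : prime p -> odd p ->
  exists a b : 'F_p, a ^+ 2 + b ^+ 2 = -1.
Proof.
move=> pr po; pose h := (p./2).+1.
have hE : (h + h = p.+1)%N by rewrite addnn /h doubleS -[in RHS](odd_double_half p) po.
have hp : (h <= p)%N by rewrite -(leq_add2r h) hE /h addnS ltnS leq_addr.
have sqI (i j : 'I_h) : (i%:R : 'F_p) ^+ 2 = (j%:R : 'F_p) ^+ 2 -> i = j.
  move/eqP; rewrite -subr_eq0 subr_sqr mulf_eq0 => /orP [|].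
    rewrite subr_eq0 => /eqP /(congr1 val); rewrite /= !val_Fp_nat //.
    by rewrite !modn_small ?(leq_trans (ltn_ord _) hp) // => /val_inj.
  rewrite -natrD -(dvdn_pcharf (pchar_Fp pr)) => /dvdn_leq H.
  apply/val_inj => /=; case: (posnP (i + j)%N) => [/eqP|/H].
    by rewrite addn_eq0 => /andP [/eqP -> /eqP ->].
  have := leq_add (ltn_ord i) (ltn_ord j); rewrite hE addSn addnS ltnS => ij.
  by rewrite leqNgt ij.
pose A := [set (i%:R : 'F_p) ^+ 2 | i : 'I_h].
pose B := [set - 1 - (i%:R : 'F_p) ^+ 2 | i : 'I_h].
have cA : #|A| = h by rewrite card_imset ?card_ord // => i j /sqI.
have cB : #|B| = h by rewrite card_imset ?card_ord // => i j /addrI/oppr_inj/sqI.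
have : A :&: B != finset.set0.
  apply/negP => /eqP AB0.
  have := max_card (mem (A :|: B)).
  by rewrite cardsU AB0 cards0 subn0 cA cB hE card_Fp // ltnn.
case/finset.set0Pn => x; rewrite inE => /andP [/imsetP [i _ ->] /imsetP [j _ E]].
by exists i%:R, j%:R; rewrite E subrK.
Qed.

Lemma sum_two_squares_succ_multiple p : prime p -> odd p ->
  exists a b c, (a * a + b * b + 1 = c * p)%N.
Proof.
move=> pr po; have [a [b E]] := sum_two_squares_Fp_eqN1 pr po.
have /dvdnP [c Ec] : (p %| a * a + b * b + 1)%N.
  rewrite (dvdn_pcharf (pchar_Fp pr)) !natrD !natrM !natr_Zp.
  by rewrite -!expr2 E addNr.
by exists a, b, c.
Qed.

End SquaresModP.

Section Integers.
Local Open Scope Z_scope.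

Definition sum_of_four_squares (n : Z) : Prop :=
  exists x y z w, n = x * x + y * y + z * z + w * w.

Lemma sum_of_four_squares_mul m n :
  sum_of_four_squares m -> sum_of_four_squares n -> sum_of_four_squares (m * n).
Proof.
move=> [a [b [c [d ->]]]] [x [y [z [w ->]]]].
exists (a * x + b * y + c * z + d * w), (a * y - b * x + c * w - d * z),
  (a * z - b * w - c * x + d * y), (a * w + b * z - c * y - d * x).
ring.
Qed.

Lemma balanced_residue m x : 0 < m -> exists y q, x = y + m * q /\ 4 * (y * y) <= m * m.
Proof.
move=> m0; have := Z.mod_pos_bound x m m0; have := Z.div_mod x m.
case: (Z_le_gt_dec (2 * (x mod m)) m) => H E B.
- by exists (x mod m), (x / m); split; [lia | nia].
- by exists (x mod m - m), (x / m + 1); split; [lia | nia].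
Qed.

(* [r] is the norm of the balanced residues divided by [m]; [m] times each entry
   of the new representation is an entry of the product of the two. *)
Lemma euler_descent m p : 1 < m -> ~ (m | p) ->
  sum_of_four_squares (m * p) ->
  exists r, 0 < r < m /\ sum_of_four_squares (r * p).
Proof.
move=> m1 mp [x [y [z [w E]]]].
have m0 : 0 < m by lia.
have [a [qa [Ea Ba]]] := balanced_residue x m0.
have [b [qb [Eb Bb]]] := balanced_residue y m0.
have [c [qc [Ec Bc]]] := balanced_residue z m0.
have [d [qd [Ed Bd]]] := balanced_residue w m0.
(* Expanding m p as the sum of (a + m qa)^2 and its three analogues shows that a^2 + b^2 + c^2 + d^2
   = m r for this r. *)
pose r := p - (2 * (a * qa + b * qb + c * qc + d * qd) + m * (qa * qa + qb * qb + qc * qc + qd * qd)).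
have Er : a * a + b * b + c * c + d * d = m * r.
  have -> : m * r = m * p - m * (2 * (a * qa + b * qb + c * qc + d * qd) + m * (qa * qa + qb * qb + qc * qc + qd * qd)) by rewrite /r; ring.
  by rewrite E Ea Eb Ec Ed; ring.
have r0 : 0 <= r by nia.
have rm : r <= m by nia.
have [t Et] : exists t, p = r + 2 * (a * qa + b * qb + c * qc + d * qd) + m * t.
  by exists (qa * qa + qb * qb + qc * qc + qd * qd); rewrite /r; ring.
clearbody r.
(* If r = 0, all residues vanish and p = m t. *)
have rn0 : r <> 0.
  move=> r00; case: mp; exists t.
  have sq0 u : u * u = 0 -> u = 0 by case/Z.mul_eq_0.
  rewrite r00 Z.mul_0_r in Er.
  have [a0 [b0 [c0 d0]]] : a = 0 /\ b = 0 /\ c = 0 /\ d = 0.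
    have := Z.square_nonneg a; have := Z.square_nonneg b.
    have := Z.square_nonneg c; have := Z.square_nonneg d => *.
    by split; [|split; [|split]]; apply: sq0; lia.
  by rewrite Et r00 a0 b0 c0 d0; ring.
(* If r = m, the bounds 4 a^2 <= m^2 are equalities, so each residue is m/2 or -m/2; then m divides
   every 2 a qa, and with them p. *)
have rnm : r <> m.
  move=> rm'; case: mp.
  have sq u q : 4 * (u * u) = m * m -> exists k, 2 * (u * q) = m * k.
    move=> H; have /Z.mul_eq_0 H0 : (2 * u - m) * (2 * u + m) = 0.
      by rewrite -(Z.sub_diag (m * m)) -[in RHS]H; ring [H].
    have [H'|H'] : 2 * u = m \/ 2 * u = - m by lia.
    - by exists q; rewrite -H'; ring.
    - by exists (- q); rewrite (_ : m = - (2 * u)); [ring | lia].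
  have Em : a * a + b * b + c * c + d * d = m * m by rewrite Er rm'.
  have [ka Ka] : exists k, 2 * (a * qa) = m * k by apply: sq; lia.
  have [kb Kb] : exists k, 2 * (b * qb) = m * k by apply: sq; lia.
  have [kc Kc] : exists k, 2 * (c * qc) = m * k by apply: sq; lia.
  have [kd Kd] : exists k, 2 * (d * qd) = m * k by apply: sq; lia.
  exists (1 + ka + kb + kc + kd + t).
  transitivity (m + (2 * (a * qa) + 2 * (b * qb) + 2 * (c * qc) + 2 * (d * qd)) + m * t).
    by rewrite Et rm'; ring.
  by rewrite Ka Kb Kc Kd; ring.
exists r; split; first by lia.
exists (a * qa + b * qb + c * qc + d * qd + r), (a * qb - b * qa + c * qd - d * qc),
  (a * qc - b * qd - c * qa + d * qb), (a * qd + b * qc - c * qb - d * qa).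
apply: (Z.mul_reg_l _ _ (m * m)); first by nia.
transitivity ((m * r) * (m * p)); first by ring.
have H1 : m * (a * qa + b * qb + c * qc + d * qd + r) = a * x + b * y + c * z + d * w.
  by rewrite Z.mul_add_distr_l -Er Ea Eb Ec Ed; ring.
have H2 : m * (a * qb - b * qa + c * qd - d * qc) = a * y - b * x + c * w - d * z.
  by rewrite Ea Eb Ec Ed; ring.
have H3 : m * (a * qc - b * qd - c * qa + d * qb) = a * z - b * w - c * x + d * y.
  by rewrite Ea Eb Ec Ed; ring.
have H4 : m * (a * qd + b * qc - c * qb - d * qa) = a * w + b * z - c * y - d * x.
  by rewrite Ea Eb Ec Ed; ring.
set X1 := _ + r in H1 *; set X2 := _ - d * qc in H2 *; set X3 := _ + d * qb in H3 *.
set X4 := _ - d * qa in H4 *.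
have -> : m * m * (X1 * X1 + X2 * X2 + X3 * X3 + X4 * X4) =
  (m * X1) * (m * X1) + (m * X2) * (m * X2) + (m * X3) * (m * X3) + (m * X4) * (m * X4) by ring.
by rewrite H1 H2 H3 H4 -Er E; ring.
Qed.

Lemma prime_not_divide (p : nat) m : prime p -> 1 < m < Z.of_nat p -> ~ (m | Z.of_nat p).
Proof.
move=> pr mp [q E].
have q0 : 0 <= q by nia.
have E' : p = (Z.to_nat q * Z.to_nat m)%N.
  by apply: Nat2Z.inj; rewrite -multE Nat2Z.inj_mul !Z2Nat.id //; lia.
have /primeP [_ /(_ (Z.to_nat m))] := pr.
by rewrite {1}E' dvdn_mull // => /(_ isT) /orP [/eqP|/eqP]; lia.
Qed.

(** For odd p, balanced residues turn a^2 + b^2 + 1 = c p into x^2 + y^2 + 1 = m p with 0 < m < p;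
    [euler_descent] then lowers m to 1. *)
Lemma sum_of_four_squares_prime (p : nat) : prime p -> sum_of_four_squares (Z.of_nat p).
Proof.
move=> pr; have p1 : 1 < Z.of_nat p by have /ltP := prime_gt1 pr; lia.
have descent m : 0 <= m -> 0 < m < Z.of_nat p -> sum_of_four_squares (m * Z.of_nat p) ->
    sum_of_four_squares (Z.of_nat p).
  move: m; apply: Z_lt_induction => m IH Hm Sm.
  case: (Z.eq_dec m 1) => [m1|m1]; first by move: Sm; rewrite m1 Z.mul_1_l.
  have [||r [Hr Sr]] := @euler_descent m (Z.of_nat p) _ _ Sm; first by lia.
    by apply: prime_not_divide => //; lia.
  by apply: (IH r) => //; lia.
have [p2|po] := even_prime pr; first by exists 1, 1, 0, 0; rewrite p2.
have [a [b [c E]]] := sum_two_squares_succ_multiple pr po.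
have {}E : Z.of_nat a * Z.of_nat a + Z.of_nat b * Z.of_nat b + 1 = Z.of_nat c * Z.of_nat p.
  by rewrite -!Nat2Z.inj_mul -Nat2Z.inj_add -(Nat2Z.inj_add _ 1) !multE !plusE E.
have p0 : 0 < Z.of_nat p by lia.
have [x [qx [Ex Bx]]] := balanced_residue (Z.of_nat a) p0.
have [y [qy [Ey By]]] := balanced_residue (Z.of_nat b) p0.
pose P := Z.of_nat p.
pose m := Z.of_nat c - (2 * x * qx + P * qx * qx + 2 * y * qy + P * qy * qy).
have Em : m * P = x * x + y * y + 1.
  rewrite /m Z.mul_sub_distr_r -E Ex Ey /P; ring.
have Hm : 0 < m < P.
  rewrite -/P in p1 Bx By; clearbody m P.
  by move: {E Ex Ey p0 descent} p1 Bx By Em; nia.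
apply: (descent m) => //; first by lia.
by exists x, y, 1, 0; rewrite -/P Em; ring.
Qed.

Theorem lagrange_four_squares (n : nat) : sum_of_four_squares (Z.of_nat n).
Proof.
elim/ltn_ind: n => n IH.
case: (ltnP 1 n) => [n1|]; last by case: n IH => [|[|//]] _ _; [exists 0, 0, 0, 0 | exists 1, 0, 0, 0].
rewrite -(divnK (pdiv_dvd n)) -multE Nat2Z.inj_mul; apply: sum_of_four_squares_mul.
  by apply/IH/ltn_Pdiv; [exact/prime_gt1/pdiv_prime | exact: ltnW].
exact/sum_of_four_squares_prime/pdiv_prime.
Qed.

(** * Moving a representation modulo 3 *)

(* Entries are signed, so that reflections apply; absolute values are compared with [c]. *)
Definition four_squares_avoiding (c n : Z) : Prop :=
  exists x y z w, n = x * x + y * y + z * z + w * w /\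
    (Z.abs x <> c /\ Z.abs y <> c /\ Z.abs z <> c /\ Z.abs w <> c).

Lemma square_mod3 x :
  x mod 3 = 0 /\ (x * x) mod 3 = 0 \/ x mod 3 <> 0 /\ (x * x) mod 3 = 1.
Proof.
have [q [r [-> Hr]]] : exists q r, x = 3 * q + r /\ 0 <= r < 3.
  by exists (x / 3), (x mod 3); lia.
have -> : (3 * q + r) * (3 * q + r) = 3 * (3 * (q * q) + 2 * (q * r)) + r * r by ring.
have [->|[->| ->]] : r = 0 \/ r = 1 \/ r = 2 by lia.
all: lia.
Qed.

Lemma normalize_mod3 x : x mod 3 <> 0 ->
  exists y, Z.abs y = Z.abs x /\ y * y = x * x /\ y mod 3 = 1.
Proof.
move=> Hx; have [H|H] : x mod 3 = 1 \/ x mod 3 = 2 by lia.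
- by exists x; lia.
- by exists (- x); split; [lia | split; [ring | lia]].
Qed.

(* Apply 3 times the reflection in (1, e, e'), with signs such that 3 does not
   divide x + e y + e' z. *)
Lemma nine_mul_three_squares x y z : (x mod 3 <> 0 \/ y mod 3 <> 0 \/ z mod 3 <> 0) ->
  exists X Y Z, 9 * (x * x + y * y + z * z) = X * X + Y * Y + Z * Z /\
    (X mod 3 <> 0 /\ Y mod 3 <> 0 /\ Z mod 3 <> 0).
Proof.
move=> Hxyz.
have [y' [z' [Hy [Hz Hs]]]] : exists y' z', y' * y' = y * y /\ z' * z' = z * z /\
    (x + y' + z') mod 3 <> 0.
  have [H|[H|[H|H]]] : (x + y + z) mod 3 <> 0 \/ (x + y + - z) mod 3 <> 0 \/
     (x + - y + z) mod 3 <> 0 \/ (x + - y + - z) mod 3 <> 0 by lia.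
  - by exists y, z.
  - by exists y, (- z); split; [|split; [ring|]].
  - by exists (- y), z; split; [ring|split].
  - by exists (- y), (- z); split; [ring|split; [ring|]].
exists (x - 2 * y' - 2 * z'), (y' - 2 * x - 2 * z'), (z' - 2 * x - 2 * y').
split; first by rewrite -Hy -Hz; ring.
lia.
Qed.

(** Divide by 3 until some entry is prime to 3, which must happen as x <> 0;
    [nine_mul_three_squares] then restores the factors 9 one at a time. *)
Lemma three_squares_coprime3 x y z : x <> 0 ->
  x mod 3 = 0 -> y mod 3 = 0 -> z mod 3 = 0 ->
  exists X Y Z, x * x + y * y + z * z = X * X + Y * Y + Z * Z /\
    (X mod 3 <> 0 /\ Y mod 3 <> 0 /\ Z mod 3 <> 0).
Proof.
have [b Hb] : exists b, Z.abs x < b by exists (Z.abs x + 1); lia.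
have Hb0 : 0 <= b by lia.
move: b Hb0 x y z Hb; apply: (Z_lt_induction (fun b => forall x y z, Z.abs x < b -> _)).
move=> b IH x y z Hb x0 Hx Hy Hz.
have [x1 Ex] : exists x1, x = 3 * x1 by exists (x / 3); lia.
have [y1 Ey] : exists y1, y = 3 * y1 by exists (y / 3); lia.
have [z1 Ez] : exists z1, z = 3 * z1 by exists (z / 3); lia.
have -> : x * x + y * y + z * z = 9 * (x1 * x1 + y1 * y1 + z1 * z1).
  by rewrite Ex Ey Ez; ring.
have [H|[Hx1 [Hy1 Hz1]]] : (x1 mod 3 <> 0 \/ y1 mod 3 <> 0 \/ z1 mod 3 <> 0) \/
   (x1 mod 3 = 0 /\ y1 mod 3 = 0 /\ z1 mod 3 = 0) by lia.
- exact: nine_mul_three_squares.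
- have [||||||X [Y [Z [-> [HX _]]]]] := IH (Z.abs x1 + 1) _ x1 y1 z1; try lia.
  by apply: nine_mul_three_squares; left.
Qed.

(* The pairs (|x/s|, |y/s|) for which each of the two reflections of [reflect_three]
   again has an entry [3 * s] or [- 3 * s]. *)
Inductive exceptional_ratio : Z -> Z -> Prop :=
| Ratio_1_1 : exceptional_ratio 1 1 | Ratio_5_5 : exceptional_ratio 5 5
| Ratio_1_2 : exceptional_ratio 1 2 | Ratio_2_1 : exceptional_ratio 2 1
| Ratio_1_5 : exceptional_ratio 1 5 | Ratio_5_1 : exceptional_ratio 5 1
| Ratio_1_7 : exceptional_ratio 1 7 | Ratio_7_1 : exceptional_ratio 7 1
| Ratio_4_7 : exceptional_ratio 4 7 | Ratio_7_4 : exceptional_ratio 7 4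
| Ratio_7_11 : exceptional_ratio 7 11 | Ratio_11_7 : exceptional_ratio 11 7.

Definition exceptional (s x y : Z) : Prop :=
  exists u v, exceptional_ratio u v /\
    (Z.abs x = u * Z.abs s /\ Z.abs y = v * Z.abs s).

Lemma exceptional_mul s x y u v : exceptional_ratio (Z.abs u) (Z.abs v) ->
  x = u * s -> y = v * s -> exceptional s x y.
Proof. by move=> Huv -> ->; exists (Z.abs u), (Z.abs v); rewrite !Z.abs_mul. Qed.

Lemma abs_neq_3mul x c : x mod 3 <> 0 -> Z.abs x <> 3 * Z.abs c.
Proof. lia. Qed.

Lemma three_entries_avoid_or c P Q R :
  (Z.abs P <> 3 * Z.abs c /\ Z.abs Q <> 3 * Z.abs c /\ Z.abs R <> 3 * Z.abs c) \/
  (P = 3 * c \/ P = - 3 * c) \/ (Q = 3 * c \/ Q = - 3 * c) \/ (R = 3 * c \/ R = - 3 * c).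
Proof.
have H p : Z.abs p <> 3 * Z.abs c \/ (p = 3 * c \/ p = - 3 * c) by lia.
by move: (H P) (H Q) (H R); tauto.
Qed.

Local Ltac ratio u v := apply: (@exceptional_mul _ _ _ u v); [constructor | lia | lia].

(** With signs chosen so that s, x and y are 1 mod 3, the difference x - y is divisible by 3, which
    makes both reflections integral. *)
Lemma reflect_three s x y : s mod 3 <> 0 -> x mod 3 <> 0 -> y mod 3 <> 0 ->
  (exists P Q R, 9 * (s * s) + x * x + y * y = P * P + Q * Q + R * R /\
    (Z.abs P <> 3 * Z.abs s /\ Z.abs Q <> 3 * Z.abs s /\ Z.abs R <> 3 * Z.abs s)) \/
  exceptional s x y.
Proof.
move=> /normalize_mod3 [s' [As [<- Hs]]] /normalize_mod3 [x' [Ax [<- Hx]]].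
move=> /normalize_mod3 [y' [Ay [<- Hy]]].
have -> : exceptional s x y = exceptional s' x' y' by rewrite /exceptional As Ax Ay.
rewrite -As => {As Ax Ay}.
have [d Hd] : exists d, x' = y' + 3 * d by exists ((x' - y') / 3); lia.
(* Reflections of (3s, x, -y) in (1, 1, 1), and of (3s, y, -x). *)
have [H|H1] := three_entries_avoid_or s' (3 * s' - 2 * (s' + d)) (x' - 2 * (s' + d)) (y' + 2 * (s' + d)).
- left; do 3 eexists; split; last exact: H.
  by rewrite Hd; ring.
have [H|H2] := three_entries_avoid_or s' (3 * s' - 2 * (s' - d)) (x' + 2 * (s' - d)) (y' - 2 * (s' - d)).
- left; do 3 eexists; split; last exact: H.
  by rewrite Hd; ring.
right; subst x'.
(* Each reflection can hit 3s or -3s in six ways. In each of the 36 combinations the two linear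
   equations are contradictory or give x and y as multiples of s. As s, x and y are 1 mod 3, so are
   the multipliers, hence the signs below. *)
case: H1 => [[]|[[]|[]]] E1; case: H2 => [[]|[[]|[]]] E2; try (exfalso; lia).
all: clear Hs Hx Hy.
all: first [ ratio 1 1 | ratio (-5) (-5) | ratio 1 (-2) | ratio (-2) 1
  | ratio 1 (-5) | ratio (-5) 1 | ratio 1 7 | ratio 7 1
  | ratio 4 7 | ratio 7 4 | ratio 7 (-11) | ratio (-11) 7 ].
Qed.

Lemma avoiding_or_contains s n x y z w : n = x * x + y * y + z * z + w * w ->
  four_squares_avoiding (3 * Z.abs s) n \/
  exists x y z, n = 9 * (s * s) + x * x + y * y + z * z.
Proof.
move=> ->.
have sq u : Z.abs u = 3 * Z.abs s -> u * u = 9 * (s * s).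
  by rewrite -(Z.abs_square u) -(Z.abs_square s) => ->; ring.
case: (Z.eq_dec (Z.abs x) (3 * Z.abs s)) => [/sq E|nx].
  by right; exists y, z, w; rewrite -E.
case: (Z.eq_dec (Z.abs y) (3 * Z.abs s)) => [/sq E|ny].
  by right; exists x, z, w; rewrite -E; ring.
case: (Z.eq_dec (Z.abs z) (3 * Z.abs s)) => [/sq E|nz].
  by right; exists x, y, w; rewrite -E; ring.
case: (Z.eq_dec (Z.abs w) (3 * Z.abs s)) => [/sq E|nw].
  by right; exists x, y, z; rewrite -E; ring.
by left; exists x, y, z, w.
Qed.

(** * Numbers congruent to 0 or 1 modulo 3 *)

Lemma avoiding_1mod3 s n x y z : s <> 0 ->
  n = 9 * (s * s) + x * x + y * y + z * z ->
  n mod 3 = 1 -> four_squares_avoiding (3 * Z.abs s) n.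
Proof.
move=> s0 En Hn.
wlog [Hx [Hy Hz]] : x y z En / x mod 3 <> 0 /\ y mod 3 = 0 /\ z mod 3 = 0.
  move=> W; have := square_mod3 x; have := square_mod3 y; have := square_mod3 z.
  move=> Hz Hy Hx.
  have [H|[H|H]] : (x mod 3 <> 0 /\ y mod 3 = 0 /\ z mod 3 = 0) \/
    (y mod 3 <> 0 /\ x mod 3 = 0 /\ z mod 3 = 0) \/
    (z mod 3 <> 0 /\ x mod 3 = 0 /\ y mod 3 = 0) by lia.
  - by apply: (W x y z).
  - by apply: (W y x z) => //; rewrite En; ring.
  - by apply: (W z x y) => //; rewrite En; ring.
have [||||X [Y [Z [E HXYZ]]]] := @three_squares_coprime3 (3 * s) y z; try lia.
by exists x, X, Y, Z; split; lia.
Qed.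

(** View the ratios as edges of a graph with loops at 1 and 5. Its triangles, loops allowed, are
    111, 112, 115, 117, 155 and 555, and m is 9 plus the sum of the three squares. *)
Lemma exceptional_triple s x y z :
  exceptional s x y -> exceptional s x z -> exceptional s y z ->
  exists m, 9 * (s * s) + x * x + y * y + z * z = s * s * m /\
    (m = 12 \/ m = 84 \/ m = 15 \/ m = 60 \/ m = 36).
Proof.
move=> [u [v [Huv [Ex Ey]]]] [u' [w [Huw [Ex' Ez]]]] [v' [w' [Hvw [Ey' Ez']]]].
case: (Z.eq_dec (Z.abs s) 0) => s0.
  by exists 12; lia.
have ? : u' = u by nia.
have ? : v' = v by nia.
have ? : w' = w by nia.
subst u' v' w'.
exists (9 + u * u + v * v + w * w); split.
  rewrite -(Z.abs_square x) -(Z.abs_square y) -(Z.abs_square z) -(Z.abs_square s).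
  by rewrite Ex Ey Ez; ring.
by move: Huw Hvw; case: Huv => {Ex Ey Ex' Ey' Ez Ez'} Huw Hvw; inversion Huw; subst; inversion Hvw; lia.
Qed.

Lemma mod4_of_even_square_multiple s m n : (s mod 2 = 0) -> n = s * s * m -> n mod 4 = 0.
Proof.
move=> Hs ->; have -> : s = 2 * (s / 2) by lia.
by rewrite (_ : _ * m = 4 * (s / 2 * (s / 2) * m)); [lia | ring].
Qed.

Lemma avoiding_0mod3 s n x y z : s mod 3 <> 0 -> (s mod 2 = 0 \/ Z.abs s = 1) ->
  n = 9 * (s * s) + x * x + y * y + z * z ->
  n mod 3 = 0 -> n mod 4 <> 0 -> (Z.abs s = 1 -> n mod 4 = 2) ->
  four_squares_avoiding (3 * Z.abs s) n.
Proof.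
move=> s3 s2 En n3 n4 n42.
have [w [X [Y [Z [E [w3 [X3 [Y3 Z3]]]]]]]] : exists w X Y Z,
  n = w * w + X * X + Y * Y + Z * Z /\
  (w mod 3 = 0 /\ X mod 3 <> 0 /\ Y mod 3 <> 0 /\ Z mod 3 <> 0).
  have := square_mod3 x; have := square_mod3 y; have := square_mod3 z => Hz Hy Hx.
  have [H|H] : (x mod 3 <> 0 /\ y mod 3 <> 0 /\ z mod 3 <> 0) \/
     (x mod 3 = 0 /\ y mod 3 = 0 /\ z mod 3 = 0) by lia.
  - by exists (3 * s), x, y, z; split; [rewrite En; ring | lia].
  - have [||||X [Y [Z [E HXYZ]]]] := @three_squares_coprime3 (3 * s) x y; try lia.
    by exists z, X, Y, Z; split; lia.
case: (Z.eq_dec (Z.abs w) (3 * Z.abs s)) => [Ew|nw]; last first.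
  exists w, X, Y, Z; split=> //.
  by have := @abs_neq_3mul _ s X3; have := @abs_neq_3mul _ s Y3; have := @abs_neq_3mul _ s Z3; tauto.
have {}E : n = 9 * (s * s) + X * X + Y * Y + Z * Z.
  by rewrite E -(Z.abs_square w) -(Z.abs_square s) Ew; ring.
(* Each pair among X, Y, Z is reflected together with 3s; the entry left over is prime to 3, so its
   absolute value is not 3|s|. *)
have [[P [Q [R [F H]]]]|EXY] := @reflect_three s X Y s3 X3 Y3.
  exists P, Q, R, Z; split; first by rewrite -F E; ring.
  by have := @abs_neq_3mul _ s Z3; tauto.
have [[P [Q [R [F H]]]]|EXZ] := @reflect_three s X Z s3 X3 Z3.
  exists P, Q, R, Y; split; first by rewrite -F E; ring.
  by have := @abs_neq_3mul _ s Y3; tauto.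
have [[P [Q [R [F H]]]]|EYZ] := @reflect_three s Y Z s3 Y3 Z3.
  exists P, Q, R, X; split; first by rewrite -F E; ring.
  by have := @abs_neq_3mul _ s X3; tauto.
have [m [Em Hm]] := exceptional_triple EXY EXZ EYZ.
(* An even s makes 4 divide n; for |s| = 1, n is one of the five values of m, none of which is 2 mod
   4. *)
exfalso; rewrite -E in Em.
case: s2 => [/mod4_of_even_square_multiple/(_ Em)//|s1].
have := n42 s1; rewrite Em -(Z.abs_square s) s1; lia.
Qed.

(** * Numbers congruent to 2 modulo 3 *)

Lemma one_multiple_2mod3 x y z : (x * x + y * y + z * z) mod 3 = 2 ->
  exists e u v, x * x + y * y + z * z = 9 * (e * e) + u * u + v * v /\
    (3 * e = x /\ u = y /\ v = z \/ 3 * e = y /\ u = x /\ v = z \/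
     3 * e = z /\ u = x /\ v = y) /\ (u mod 3 <> 0 /\ v mod 3 <> 0).
Proof.
have := square_mod3 x; have := square_mod3 y; have := square_mod3 z => Hz Hy Hx Hn.
have [H|[H|H]] : (x mod 3 = 0 /\ y mod 3 <> 0 /\ z mod 3 <> 0) \/
    (y mod 3 = 0 /\ x mod 3 <> 0 /\ z mod 3 <> 0) \/
    (z mod 3 = 0 /\ x mod 3 <> 0 /\ y mod 3 <> 0) by lia.
- have E : 3 * (x / 3) = x by lia.
  by exists (x / 3), y, z; split; [rewrite -{1 2}E; ring | tauto].
- have E : 3 * (y / 3) = y by lia.
  by exists (y / 3), x, z; split; [rewrite -{1 2}E; ring | tauto].
- have E : 3 * (z / 3) = z by lia.
  by exists (z / 3), x, y; split; [rewrite -{1 2}E; ring | tauto].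
Qed.

Lemma avoiding_or_exceptional s n e x y : s mod 3 <> 0 ->
  x mod 3 <> 0 -> y mod 3 <> 0 -> Z.abs e <> Z.abs s ->
  n = 9 * (s * s) + 9 * (e * e) + x * x + y * y ->
  four_squares_avoiding (3 * Z.abs s) n \/ exceptional s x y.
Proof.
move=> s3 x3 y3 es En.
have [[P [Q [R [F H]]]]|] := @reflect_three s x y s3 x3 y3; last by right.
left; exists (3 * e), P, Q, R; split; first by rewrite En -Z.add_assoc; lia.
split; last exact: H.
by clear -es; lia.
Qed.

Lemma exceptional_bound s x y : exceptional s x y ->
  Z.abs x <= 11 * Z.abs s /\ Z.abs y <= 11 * Z.abs s.
Proof. by case=> u [v [[] H]]; lia. Qed.

Lemma exceptional_mod4 s x y : s mod 4 = 0 -> exceptional s x y ->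
  x mod 4 = 0 /\ y mod 4 = 0.
Proof. by move=> s4 [u [v [[] H]]]; lia. Qed.

(** The values u^2 + v^2 over the exceptional ratios; 50 is both 25 + 25 and 1 + 49. *)
Definition exceptional_norms : seq nat := [:: 2; 5; 26; 50; 65; 170]%N.

Lemma exceptional_sum s x y : exceptional s x y ->
  exists2 m : nat, m \in exceptional_norms & x * x + y * y = s * s * Z.of_nat m.
Proof.
move=> [u [v [H [Ex Ey]]]]; exists (Z.to_nat (u * u + v * v)); first by case: H {Ex Ey}.
rewrite -(Z.abs_square x) -(Z.abs_square y) -(Z.abs_square s) Ex Ey Z2Nat.id; last by nia.
by ring.
Qed.

(** As (x, y) blocks the reflections of 3s, reflect 3e and keep 3s. The new triple has exactly one
    entry 3f divisible by 3. If |f| <> |s|, reflecting 3s with the other two entries succeeds unless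
    they form an exceptional pair. In the remaining cases some new entry is a small multiple of s,
    which bounds e. *)
Lemma exceptional_move s n e x y : s mod 3 <> 0 -> n mod 3 = 2 ->
  x mod 3 <> 0 -> y mod 3 <> 0 -> exceptional s x y ->
  n = 9 * (s * s) + 9 * (e * e) + x * x + y * y ->
  four_squares_avoiding (3 * Z.abs s) n \/
  (Z.abs e <= 26 * Z.abs s /\ (s mod 4 = 0 -> e mod 2 = 0)).
Proof.
move=> s3 n3 /normalize_mod3 [x' [Ax [<- x3]]] /normalize_mod3 [y' [Ay [<- y3]]].
rewrite (_ : exceptional s x y = exceptional s x' y'); last by rewrite /exceptional Ax Ay.
move=> {Ax Ay}; move: x' y' x3 y3 => {x y} x y x3 y3 Hxy En.
have [Bx By] := exceptional_bound Hxy.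
have H4 : s mod 4 = 0 -> x mod 4 = 0 /\ y mod 4 = 0 by move/exceptional_mod4/(_ Hxy).
have [d Ed] : exists d, x = y + 3 * d by exists ((x - y) / 3); lia.
(* Reflect (3e, x, -y) in (1, 1, 1). *)
have {}En : n = 9 * (s * s) + ((3 * e - 2 * (e + d)) * (3 * e - 2 * (e + d)) +
    (x - 2 * (e + d)) * (x - 2 * (e + d)) + (y + 2 * (e + d)) * (y + 2 * (e + d))).
  by rewrite En Ed; ring.
have [|f [u [v [E [Huv [u3 v3]]]]]] := @one_multiple_2mod3 (3 * e - 2 * (e + d))
  (x - 2 * (e + d)) (y + 2 * (e + d)); first by lia.
have {E} En : n = 9 * (s * s) + 9 * (f * f) + u * u + v * v by rewrite En E; ring.
(* Given x and y, any one of the entries e - 2d, x - 2(e + d), y + 2(e + d) determines e. At worst e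
   = 2d + u with |d| <= 22|s|/3 and |u| <= 11|s|, whence the constant 26. If 4 divides s, it divides
   x, y, d and the entries that are multiples of s; since two of the three contain 2e, only the
   parity of e is obtained. *)
case: (Z.eq_dec (Z.abs f) (Z.abs s)) => [fs|fs].
  right; move: {En n3 u3 v3 Hxy x3 y3} Huv => [|[|]] [E1 [_ _]];
    (split; [lia | move=> s4; move: (H4 s4); clear Bx By; lia]).
have [|Huv'] := avoiding_or_exceptional s3 u3 v3 fs En; first by left.
have [Bu Bv] := exceptional_bound Huv'.
have H4' : s mod 4 = 0 -> u mod 4 = 0 /\ v mod 4 = 0 by move/exceptional_mod4/(_ Huv').
right; move: {En n3 u3 v3 Hxy x3 y3} Huv => [|[|]] [E1 [E2 E3]].
all: split; [clear H4 H4'; lia | move=> s4; move: (H4 s4) (H4' s4); clear Bx By Bu Bv H4 H4'; lia].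
Qed.

(* The search keeps [w] near [Z.sqrt n] and [x], [y] small; for [r < 0] the square root is 0 and the test fails. *)
Definition find_avoiding (c n : Z) : bool :=
  let ok x := negb (Z.abs x =? c) in
  has (fun i => has (fun x => has (fun y =>
    let w := Z.sqrt n - i in
    let r := n - w * w - x * x - y * y in
    let z := Z.sqrt r in
    (z * z =? r) && ok x && ok y && ok z && ok w)
   (map Z.of_nat (iota 0 10))) (map Z.of_nat (iota 0 10))) (map Z.of_nat (iota 0 10)).

Lemma find_avoidingP c n : find_avoiding c n -> four_squares_avoiding c n.
Proof.
have H (T : Type) (p : T -> bool) l : has p l -> exists x, p x.
  by elim: l => //= x l IH /orP [?|/IH //]; exists x.
move=> /H [i /H [x /H [y]]]; cbv beta zeta; set w := Z.sqrt n - i; set z := Z.sqrt _.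
move=> /andP [/andP [/andP [/andP [E ox] oy] oz] ow].
exists x, y, z, w; split; first by move: E => /Z.eqb_eq; lia.
by move: ox oy oz ow => /negP ox /negP oy /negP oz /negP ow; rewrite -!Z.eqb_eq.
Qed.


Lemma square_mod8 x :
  x mod 2 = 0 /\ (x * x) mod 4 = 0 \/ x mod 2 = 1 /\ (x * x) mod 8 = 1.
Proof.
have [q [E|E]] : exists q, x = 2 * q \/ x = 2 * q + 1 by exists (x / 2); lia.
  have Ex : x * x = 4 * (q * q) by rewrite E; ring.
  by left; rewrite Ex; lia.
have [t Et] : exists t, q * q + q = 2 * t.
  have [r [E'|E']] : exists r, q = 2 * r \/ q = 2 * r + 1 by exists (q / 2); lia.
    by exists (2 * (r * r) + r); rewrite E'; ring.
  by exists (2 * (r * r) + 3 * r + 1); rewrite E'; ring.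
have Ex : x * x = 4 * (q * q + q) + 1 by rewrite E; ring.
by right; rewrite Ex; lia.
Qed.

(** The case |s| = 2: here k = |e| is at most 52, and it is odd because 4 does not divide n. *)
Lemma avoiding_6_check : all (fun k => all (fun m =>
    find_avoiding 6 (36 + 9 * (Z.of_nat k * Z.of_nat k) + 4 * Z.of_nat m))
  exceptional_norms) [seq k <- iota 0 53 | odd k].
Proof. by vm_compute. Qed.

(** The case |s| = 1: n = 2 mod 4 forces e to be even and m to be 5 or 65. The pair k = 0, m = 5 is
    n = 14. *)
Lemma avoiding_3_check : all (fun k => all (fun m => ((k == 0%N) && (m == 5%N)) ||
    find_avoiding 3 (9 + 9 * (Z.of_nat k * Z.of_nat k) + Z.of_nat m))
  [:: 5; 65]%N) [seq k <- iota 0 53 | ~~ odd k].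
Proof. by vm_compute. Qed.

(** Here n = s^2 (9 + m) + 9 e^2 with m in [exceptional_norms]. If [exceptional_move] yields only
    the bound, then either 4 divides s, so e is even and 4 divides n, or |s| <= 2 and finitely many
    n remain for the searches. *)
Lemma avoiding_exceptional s n e x y : s mod 3 <> 0 ->
  s mod 4 = 0 \/ Z.abs s = 2 \/ Z.abs s = 1 ->
  n mod 3 = 2 -> n mod 4 <> 0 -> (Z.abs s = 1 -> n mod 4 = 2 /\ n <> 14) ->
  x mod 3 <> 0 -> y mod 3 <> 0 -> exceptional s x y ->
  n = 9 * (s * s) + 9 * (e * e) + x * x + y * y ->
  four_squares_avoiding (3 * Z.abs s) n.
Proof.
move=> s3 s2 n3 n4 n1 x3 y3 Hxy En.
have [//|[Be He]] := exceptional_move s3 n3 x3 y3 Hxy En.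
have [m mP Em] := exceptional_sum Hxy.
have {}En : n = s * s * (9 + Z.of_nat m) + 9 * (e * e) by rewrite En; lia.
have e2 := square_mod8 e.
have [k Ek] : exists k, Z.abs e = Z.of_nat k.
  by exists (Z.to_nat (Z.abs e)); rewrite Z2Nat.id //; apply: Z.abs_nonneg.
have Eee : e * e = Z.of_nat k * Z.of_nat k by rewrite -(Z.abs_square e) Ek.
have kodd : odd k = (e mod 2 =? 1).
  have := odd_double_half k; rewrite -addnn -!plusE.
  by case: (odd k) => /= Hk; symmetry; [apply/Z.eqb_eq | apply/Z.eqb_neq]; lia.
case: s2 => [s4|[s2|s1]].
- case: n4; have e20 := He s4.
  have [q Eq] : exists q, s = 4 * q by exists (s / 4); lia.
  have [f Ef] : exists f, e = 2 * f by exists (e / 2); lia.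
  have -> : n = (4 * (q * q) * (9 + Z.of_nat m) + 9 * (f * f)) * 4 by rewrite En Eq Ef; ring.
  by rewrite Z_mod_mult.
- have Es : s * s = 4 by rewrite -(Z.abs_square s) s2.
  have Hk : k \in [seq k <- iota 0 53 | odd k].
    rewrite mem_filter mem_iota kodd; apply/andP; split; first by apply/Z.eqb_eq; lia.
    by apply/andP; split=> //; apply/ltP; rewrite add0n; lia.
  have /allP/(_ m mP)/find_avoidingP := allP avoiding_6_check k Hk.
  by rewrite s2 (_ : _ + _ = n) // En Es Eee; ring.
- have Es : s * s = 1 by rewrite -(Z.abs_square s) s1.
  have [n42 n14] := n1 s1.
  have e20 : e mod 2 = 0.
    by move: mP En; rewrite !inE Es; do ![case/orP|move/eqP=> ->]; lia.
  have Hm : m \in [:: 5; 65]%N.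
    by move: mP En; rewrite !inE Es; do ![case/orP|move/eqP=> ->] => //; lia.
  have Hk : k \in [seq k <- iota 0 53 | ~~ odd k].
    rewrite mem_filter mem_iota kodd; apply/andP; split; first by apply/negP => /Z.eqb_eq; lia.
    by apply/andP; split=> //; apply/ltP; rewrite add0n; lia.
  have /allP/(_ m Hm)/orP[/andP[/eqP k0 /eqP m5]|/find_avoidingP] := allP avoiding_3_check k Hk.
    by case: n14; rewrite En Es Eee k0 m5.
  by rewrite s1 (_ : _ + _ = n) // En Es Eee; ring.
Qed.

Lemma avoiding_2mod3 s n x y z : s mod 3 <> 0 ->
  s mod 4 = 0 \/ Z.abs s = 2 \/ Z.abs s = 1 ->
  n mod 3 = 2 -> n mod 4 <> 0 -> (Z.abs s = 1 -> n mod 4 = 2 /\ n <> 14) ->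
  n = 9 * (s * s) + x * x + y * y + z * z ->
  four_squares_avoiding (3 * Z.abs s) n.
Proof.
move=> s3 s2 n3 n4 n1 En.
have [|e [u [v [E [_ [u3 v3]]]]]] := @one_multiple_2mod3 x y z; first by lia.
have {E}En : n = 9 * (s * s) + 9 * (e * e) + u * u + v * v by rewrite En; lia.
have avoid_of_neq f a b : Z.abs f <> Z.abs s -> a mod 3 <> 0 -> b mod 3 <> 0 ->
    n = 9 * (s * s) + 9 * (f * f) + a * a + b * b -> four_squares_avoiding (3 * Z.abs s) n.
  move=> fs a3 b3 E; have [//|H] := avoiding_or_exceptional s3 a3 b3 fs E.
  exact: (avoiding_exceptional s3 s2 n3 n4 n1 a3 b3 H E).
(* If |e| = |s|, then n = 18 s^2 + u^2 + v^2. Reflecting one of the two entries 3s gives P, Q, R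
   with a single multiple 3f of 3, where |f| <> |s| because P, Q, R avoid 3s; the other 3s is then
   the one to treat. *)
case: (Z.eq_dec (Z.abs e) (Z.abs s)) => es; last exact: (avoid_of_neq e u v).
have {}es : e * e = s * s by rewrite -(Z.abs_square e) es Z.abs_square.
have [[P [Q [R [F [nP [nQ nR]]]]]]|Huv] := reflect_three s3 u3 v3.
  have [|f [a [b [E [Hf [a3 b3]]]]]] := @one_multiple_2mod3 P Q R.
    by move: n3; rewrite -F En es; clear; lia.
  apply: (avoid_of_neq f a b) => //; last by move: F; rewrite En es E; clear; lia.
  move: {E F n3 n4 n1 s2 s3 u3 v3 a3 b3 En avoid_of_neq es} Hf; lia.
have [m mP Em] := exceptional_sum Huv.
have {}En : n = s * s * (18 + Z.of_nat m) by rewrite En es; lia.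
case: (Z.eq_dec (Z.abs s) 1) => [s1|s1]; last first.
  by case: n4; apply: (mod4_of_even_square_multiple _ En); lia.
(* Now n = 18 + m = 2 mod 4 would need 4 to divide m, but no exceptional norm is a multiple of 4. *)
have [n42 _] := n1 s1; move: mP En; rewrite -(Z.abs_square s) s1 !inE.
by do ![case/orP|move/eqP=> ->]; lia.
Qed.

Lemma four_squares_avoiding_not4 s n x y z w : s mod 3 <> 0 ->
  s mod 4 = 0 \/ Z.abs s = 2 \/ Z.abs s = 1 ->
  n mod 4 <> 0 -> (Z.abs s = 1 -> n mod 4 = 2 /\ n <> 14) ->
  n = x * x + y * y + z * z + w * w ->
  four_squares_avoiding (3 * Z.abs s) n.
Proof.
move=> s3 s2 n4 n1 En.
have [//|[a [b [c E]]]] := avoiding_or_contains s En.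
have [n3|[n3|n3]] : n mod 3 = 0 \/ n mod 3 = 1 \/ n mod 3 = 2 by lia.
- by apply: (avoiding_0mod3 _ _ E) => //; [lia | move/n1; case].
- by apply: (avoiding_1mod3 _ E) => //; move=> s0; rewrite s0 in s3.
- exact: (avoiding_2mod3 _ s2 _ _ _ E).
Qed.

(** * Descent by powers of 4 *)

Lemma four_squares_avoiding_double c n :
  four_squares_avoiding c n -> four_squares_avoiding (2 * c) (4 * n).
Proof.
have H u : Z.abs u <> c -> Z.abs (2 * u) <> 2 * c by lia.
move=> [x [y [z [w [-> [Hx [Hy [Hz Hw]]]]]]]].
exists (2 * x), (2 * y), (2 * z), (2 * w); split; first by ring.
by split; [|split; [|split]]; apply: H.
Qed.

Lemma four_odd_squares n : n mod 2 = 1 -> sum_of_four_squares n ->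
  exists x y z w, 4 * n = x * x + y * y + z * z + w * w /\
    (x mod 2 = 1 /\ y mod 2 = 1 /\ z mod 2 = 1 /\ w mod 2 = 1).
Proof.
move=> n2 [x [y [z [w E]]]].
(* The signs form a Hadamard matrix of order 4, so the norm is multiplied by 4; every entry has the
   parity of x + y + z + w, which is that of n. *)
exists (x + y + z + w), (x + y - z - w), (x - y + z - w), (x - y - z + w).
split; first by rewrite E; ring.
have := square_mod8 x; have := square_mod8 y; have := square_mod8 z; have := square_mod8 w.
by move=> Hw Hz Hy Hx; have : (x + y + z + w) mod 2 = 1; lia.
Qed.

Lemma four_squares_nonneg n : 0 <= n -> sum_of_four_squares n.
Proof. by move=> n0; rewrite -(Z2Nat.id n) //; apply: lagrange_four_squares. Qed.

Lemma pow2_mod3 k : 0 <= k -> 2 ^ k mod 3 <> 0.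
Proof.
by move: k; apply: natlike_ind => // k k0 IH; rewrite Z.pow_succ_r //; lia.
Qed.

Lemma pow2_cases k : 0 <= k -> k = 0 \/ k = 1 \/ (2 ^ k) mod 4 = 0.
Proof.
move=> k0; have [?|[?|k2]] : k = 0 \/ k = 1 \/ 2 <= k by lia.
- by left.
- by right; left.
- right; right; have E : 2 ^ (k - 2 + 2) = 2 ^ (k - 2) * 4 by apply: Z.pow_add_r; lia.
  by rewrite Z.sub_add in E; rewrite E Z_mod_mult.
Qed.

(** The range includes k = 0 so that halving can go down from 6 to 3. The evenness needed there
    survives the descent, since n is replaced by n/4 only when 8 divides n. *)
Lemma four_squares_avoiding_3pow2 k n : 0 <= k -> 0 <= n -> n <> 14 * 4 ^ k ->
  (k = 0 -> n mod 2 = 0) -> four_squares_avoiding (3 * 2 ^ k) n.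
Proof.
move=> k0; move: k k0 n; apply: natlike_ind => [|k k0 IH] n n0 n14 neven.
  case: (Z.eq_dec (n mod 4) 0) => n4; last first.
    have [x [y [z [w E]]]] := four_squares_nonneg n0.
    by apply: (four_squares_avoiding_not4 (s := 1) _ _ n4 _ E) => //; [right; right | lia].
  have [m En] : exists m, n = 4 * m by exists (n / 4); lia.
  have [|x [y [z [w E]]]] := @four_squares_nonneg m; first by lia.
  exists (2 * x), (2 * y), (2 * z), (2 * w); split; first by rewrite En E; ring.
  have H u : Z.abs (2 * u) <> 3 * 2 ^ 0 by rewrite Z.mul_1_r; lia.
  by split; [|split; [|split]]; apply: H.
have k1 : 0 <= Z.succ k by lia.
have s0 : 0 < 2 ^ k by apply: Z.pow_pos_nonneg.
have s2 : 2 ^ Z.succ k = 2 * 2 ^ k by apply: Z.pow_succ_r.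
case: (Z.eq_dec (n mod 4) 0) => n4; last first.
  have [x [y [z [w E]]]] := four_squares_nonneg n0.
  rewrite -(Z.abs_eq (2 ^ Z.succ k)); last by lia.
  apply: (four_squares_avoiding_not4 _ _ n4 _ E); [exact: pow2_mod3 | | by lia].
  by have [?|[->|?]] := pow2_cases k1; [lia | right; left | left].
have [m En] : exists m, n = 4 * m by exists (n / 4); lia.
case: (Z.eq_dec (m mod 2) 0) => m2.
  rewrite En s2 Z.mul_assoc (Z.mul_comm 3 2) -Z.mul_assoc.
  apply/four_squares_avoiding_double/IH; [lia | | by []].
  by move=> m14; case: n14; rewrite En m14 Z.pow_succ_r //; ring.
have [||x [y [z [w [E [Hx [Hy [Hz Hw]]]]]]]] := @four_odd_squares m; first by lia.
  by apply: four_squares_nonneg; lia.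
exists x, y, z, w; split; first by rewrite En.
have H u : u mod 2 = 1 -> Z.abs u <> 3 * 2 ^ Z.succ k by rewrite s2; lia.
by split; [|split; [|split]]; apply: H.
Qed.

(** For k = 0 only the squares 0, 1 and 4 are available, and no four of them add up to 14. For
    larger k the number is a multiple of 8, which forces all four entries to be even, so they can be
    halved. *)
Lemma not_four_squares_avoiding k : 0 <= k -> ~ four_squares_avoiding (3 * 2 ^ k) (14 * 4 ^ k).
Proof.
move: k; apply: natlike_ind => [|k k0 IH] [x [y [z [w [E [nx [ny [nz nw]]]]]]]].
  rewrite /= in E nx ny nz nw.
  have sq u : u * u <= 14 -> Z.abs u <> 3 -> u * u = 0 \/ u * u = 1 \/ u * u = 4.
    move=> H n3; have {}n3 : u = 0 \/ u = 1 \/ u = -1 \/ u = 2 \/ u = -2 by nia.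
    by case: n3 => [->|[->|[->|[->| ->]]]]; lia.
  have := Z.square_nonneg x; have := Z.square_nonneg y.
  have := Z.square_nonneg z; have := Z.square_nonneg w => pw pz py px.
  have {px py pz pw} [bx [bY [bz bw]]] :
    x * x <= 14 /\ y * y <= 14 /\ z * z <= 14 /\ w * w <= 14 by move: E px py pz pw; clear; lia.
  move: (sq x bx nx) (sq y bY ny) (sq z bz nz) (sq w bw nw) E; clear; lia.
have [Hx [Hy [Hz Hw]]] : x mod 2 = 0 /\ y mod 2 = 0 /\ z mod 2 = 0 /\ w mod 2 = 0.
  have := square_mod8 x; have := square_mod8 y; have := square_mod8 z; have := square_mod8 w.
  by move: E; rewrite Z.pow_succ_r //; clear; lia.
case: IH; exists (x / 2), (y / 2), (z / 2), (w / 2).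
rewrite !Z.pow_succ_r // in E nx ny nz nw.
have half u : u mod 2 = 0 -> u = 2 * (u / 2) by clear; lia.
have H u : Z.abs u <> 3 * (2 * 2 ^ k) -> u mod 2 = 0 -> Z.abs (u / 2) <> 3 * 2 ^ k.
  by clear; lia.
split; last by split; [|split; [|split]]; apply: H.
by rewrite (half x) // (half y) // (half z) // (half w) // in E; move: E; clear; lia.
Qed.

End Integers.

(** * Values of [k_] *)

Lemma sum_of_squares4P rho n :
  sum_of_squares rho 4 n <-> four_squares_avoiding (Z.of_nat rho) (Z.of_nat n).
Proof.
have sqE (u : nat) : (Z.of_nat (u ^ 2) = Z.of_nat u * Z.of_nat u)%Z.
  by rewrite -mulnn -multE Nat2Z.inj_mul.
have absE u : Z.of_nat (Z.to_nat (Z.abs u)) = Z.abs u by apply/Z2Nat.id/Z.abs_nonneg.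
split=> [[x [Hx ->]]|[x [y [z [w [E [Hx [Hy [Hz Hw]]]]]]]]].
  rewrite !big_ord_recr big_ord0 /= add0n -!plusE !Nat2Z.inj_add !sqE.
  have H i : (Z.abs (Z.of_nat (x i)) <> Z.of_nat rho)%Z.
    by move=> H; apply: (Hx i) => /=; lia.
  by do 4 eexists; split; [reflexivity | split; [|split; [|split]]; apply: H].
pose s := [:: Z.to_nat (Z.abs x); Z.to_nat (Z.abs y); Z.to_nat (Z.abs z); Z.to_nat (Z.abs w)].
exists (fun i => nth 0 s i); split.
  by move=> i; rewrite /S_ /=; case: i => [[|[|[|[|//]]]] i4] /=; lia.
rewrite !big_ord_recr big_ord0 /= add0n; apply: Nat2Z.inj.
by rewrite -!plusE !Nat2Z.inj_add !sqE !absE !Z.abs_square.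
Qed.

Lemma sum_of_squaresS rho m n : 0 < rho ->
  sum_of_squares rho m n -> sum_of_squares rho m.+1 n.
Proof.
move=> rho0 [x [Hx ->]].
(* [unlift ord0] is [None] exactly at the first index, so this prepends 0, which differs from
   [rho]. *)
exists (fun i => oapp x 0 (unlift ord0 i)); split=> [i|].
  rewrite /S_ /=; case: (unlift ord0 i) => [j|] /=; first exact: Hx.
  by move=> E; rewrite -E in rho0.
by rewrite big_ord_recl unlift_none /= add0n; apply: eq_bigr => i _; rewrite liftK.
Qed.

Lemma sum_of_squares_leq rho m m' n : 0 < rho -> m <= m' ->
  sum_of_squares rho m n -> sum_of_squares rho m' n.
Proof.
by move=> rho0 /subnK <- H; elim: (m' - m) => // k; rewrite addSn; apply: sum_of_squaresS.
Qed.

Lemma k_le rho m n k : 0 < m -> sum_of_squares rho m n -> k_ rho n = Some k -> k <= m.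
Proof.
move=> m0 H; rewrite /k_; case: pselect => // ex [<-].
by case: ex_minnP => k' _; apply; apply/asboolP.
Qed.

Lemma k_succ rho m n : 0 < rho -> ~ sum_of_squares rho m n ->
  sum_of_squares rho m.+1 n -> k_ rho n = Some m.+1.
Proof.
move=> rho0 nH H; rewrite /k_; case: pselect => [ex|[]]; last first.
  by exists m.+1; apply/asboolP.
congr Some; case: ex_minnP => k' /asboolP [_ Hk'] Hmin; apply/eqP; rewrite eqn_leq.
apply/andP; split; first by apply: Hmin; apply/asboolP.
by rewrite ltnNge; apply/negP => k'm; apply/nH/(sum_of_squares_leq rho0 k'm).
Qed.

Theorem theorem3p3 (a rho : nat) (hrho : rho = 3 * 2 ^ (a + 1)) :
  (forall n : nat, 0 < n -> n <> 14 * 2 ^ (2 * a + 2) ->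
     sum_of_squares rho 4 n) /\
  sum_of_squares rho 5 (14 * 2 ^ (2 * a + 2)) /\
  M_ rho = 5.
Proof.
set N := 14 * 2 ^ (2 * a + 2).
have rho0 : 0 < rho by rewrite hrho muln_gt0 expn_gt0.
have powE (b : nat) k : Z.of_nat (b ^ k) = (Z.of_nat b ^ Z.of_nat k)%Z.
  elim: k => // k IH; rewrite expnS -multE Nat2Z.inj_mul IH Nat2Z.inj_succ Z.pow_succ_r //.
  exact: Nat2Z.is_nonneg.
pose k := Z.of_nat (a + 1).
have k0 : (0 <= k)%Z by exact: Nat2Z.is_nonneg.
have Erho : Z.of_nat rho = (3 * 2 ^ k)%Z by rewrite hrho -multE Nat2Z.inj_mul powE.
have EN : Z.of_nat N = (14 * 4 ^ k)%Z.
  have -> : N = 14 * (2 ^ 2) ^ (a + 1) by rewrite /N -expnM mulnDr.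
  by rewrite -multE Nat2Z.inj_mul powE.
have four n : 0 < n -> n <> N -> sum_of_squares rho 4 n.
  move=> n0 nN; apply/sum_of_squares4P; rewrite Erho; apply: four_squares_avoiding_3pow2 => //.
  - exact: Nat2Z.is_nonneg.
  - by rewrite -EN => /Nat2Z.inj.
  - by rewrite /k addn1 Nat2Z.inj_succ; lia.
have not4 : ~ sum_of_squares rho 4 N.
  by move/sum_of_squares4P; rewrite Erho EN; apply: not_four_squares_avoiding.
have five : sum_of_squares rho 5 N.
  pose c := 2 ^ (a + 1); have c0 : 0 < c by rewrite expn_gt0.
  (* This is 14 = 4 + 4 + 4 + 1 + 1 scaled by c^2, where [rho] is 3c. *)
  exists (fun i : 'I_5 => nth 0 [:: 2 * c; 2 * c; 2 * c; c; c] i); split.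
    rewrite /S_ /= hrho -/c => i E; have : nth 0 [:: 2; 2; 2; 1; 1] i * c = 3 * c.
      by rewrite -E; case: i {E} => [[|[|[|[|[|//]]]]] i5] /=; rewrite ?mul1n.
    move/eqP; rewrite eqn_pmul2r //.
    by case: i {E} => [[|[|[|[|[|//]]]]] i5].
  rewrite !big_ord_recr big_ord0 /= add0n /N (_ : 2 * a + 2 = (a + 1) * 2); last first.
    by rewrite mulnDl mulnC.
  by rewrite expnM -/c !expnMn; move: (c ^ 2) => t; rewrite -[2 ^ 2]/4 -!multE -!plusE; lia.
split; [exact: four | split=> //].
have le5 m : k_values rho m -> m <= 5.
  move=> [n [n1 _]]; apply: k_le => //.
  by case: (eqVneq n N) => [->//|/eqP nN]; apply/(sum_of_squaresS rho0)/four.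
have mem5 : k_values rho 5.
  exists N; rewrite /I_ /= (k_succ rho0 not4 five); split=> //; last by case.
  by rewrite /N muln_gt0 expn_gt0.
(* The value 5 is attained and bounds all the others, so [xget] does not fall back on its
   default. *)
apply: xget_unique; first by split.
by move=> m [/le5 m5 /(_ _ mem5) m5']; apply/eqP; rewrite eqn_leq m5 m5'.
Qed.
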